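(* Let $(b_j^k)_{1\le k\le j}$ be the unique family of polynomials in $\mathbb{Z}[q]$ satisfying $b_j^j=1$ for $j\ge1$, $b_j^1=(1-q^2)\cdots(1-q^j)$ for $j\ge2$, and $b_j^k=b_{j-1}^{k-1}+(1-q^j)\,b_{j-1}^k-b_{j-2}^{k-1}$ for $2\le k\le j-1$. Let $P$ be the infinite lower unitriangular matrix, with rows and columns indexed by the positive integers, whose $(i,j)$ entry is $b_i^j$ for $j\le i$ and $0$ for $j>i$, and let $(c_i^1)_{i\ge1}$ be the first column of $P^{-1}$. Then, for all $n\ge1$, $$c_{n+2}^1=-(1-q^2)u_n=-(1-q^2)\,q^{n+1}a_{n-1},$$ where $u_n=q^{n+1}a_{n-1}$ and $a_m=a_m(q)$ is the Poincaré polynomial of the set of fully commutative elements of the Coxeter group $W(A_m)$.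
   Context: Superscripts in $b_j^k$ and $c_i^1$ are indices, not exponents. For a positive integer $n$, $W(A_n)$ is the Coxeter group with generators $\sigma_1,\dots,\sigma_n$ and relations $\sigma_i^2=1$, $\sigma_i\sigma_{i+1}\sigma_i=\sigma_{i+1}\sigma_i\sigma_{i+1}$ for $1\le i\le n-1$, and $\sigma_i\sigma_j=\sigma_j\sigma_i$ for $|i-j|\ge 2$; $W(A_0)=1$. The length $l(w)$ is the minimal number of generators in an expression of $w$; expressions of this length are called reduced. An element is fully commutative if any of its reduced expressions can be obtained from any other by applying only commutation relations $\sigma_i\sigma_j=\sigma_j\sigma_i$, $|i-j|\ge2$; $W^c(A_n)$ is the set of fully commutative elements of $W(A_n)$, and $a_n=\sum_{w\in W^c(A_n)}q^{l(w)}$, with $a_0=1$. *)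

(* Defs.v *)
From HB Require Import structures.
From mathcomp Require Import all_boot all_order all_algebra.
From mathcomp Require Import generic_quotient.
From mathcomp Require Import boolp classical_sets functions cardinality fsbigop.

Set Implicit Arguments.
Unset Strict Implicit.
Unset Printing Implicit Defensive.

Import GRing.Theory.

Local Open Scope nat_scope.

(* Words are sequences of letters; [word_cong R] is the least congruence of the
   free monoid containing R. *)
Section WordCongruence.
Variable T : Type.
Variable R : seq T -> seq T -> Prop.

Inductive word_cong : seq T -> seq T -> Prop :=
| word_cong_step u v s t :
    R s t -> word_cong (u ++ s ++ v) (u ++ t ++ v)
| word_cong_refl s : word_cong s s
| word_cong_sym s t : word_cong s t -> word_cong t s
| word_cong_trans s t r : word_cong s t -> word_cong t r -> word_cong s r.

Lemma word_cong_cat u v s t :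
  word_cong s t -> word_cong (u ++ s ++ v) (u ++ t ++ v).
Proof.
elim=> [u' v' s' t' st|s'|s' t' _|s' t' r' _ st _ tr].
- have := word_cong_step (u ++ u') (v' ++ v) st.
  by rewrite -!catA.
- exact: word_cong_refl.
- exact: word_cong_sym.
- exact: word_cong_trans st tr.
Qed.

Lemma word_cong_cat2 s s' t t' :
  word_cong s s' -> word_cong t t' -> word_cong (s ++ t) (s' ++ t').
Proof.
move=> ss' tt'; apply: (word_cong_trans (t := s' ++ t)).
  exact: (word_cong_cat [::] t ss').
by have := word_cong_cat s' [::] tt'; rewrite !cats0.
Qed.

End WordCongruence.

(* The letter i : 'I_n stands for the generator sigma_{i+1} of W(A_n). *)
Section CoxeterA.
Variable n : nat.

Inductive commutation : seq 'I_n -> seq 'I_n -> Prop :=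
| Commutation (i j : 'I_n) :
    (i.+2 <= j) || (j.+2 <= i) -> commutation [:: i; j] [:: j; i].

Inductive coxeter_relation : seq 'I_n -> seq 'I_n -> Prop :=
| CoxSquare (i : 'I_n) : coxeter_relation [:: i; i] [::]
| CoxBraid (i j : 'I_n) :
    j = i.+1 :> nat -> coxeter_relation [:: i; j; i] [:: j; i; j]
| CoxCommutation s t : commutation s t -> coxeter_relation s t.

Definition coxeter_eqb : rel (seq 'I_n) :=
  fun s t => `[< word_cong coxeter_relation s t >].

Lemma coxeter_eqb_equiv : equiv_class_of coxeter_eqb.
Proof.
split=> [s|s t|t s r].
- by apply/asboolP; apply: word_cong_refl.
- by apply/asboolP/asboolP; apply: word_cong_sym.
- move=> /asboolP st /asboolP tr; apply/asboolP.
  exact: word_cong_trans st tr.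
Qed.

Canonical coxeter_equiv := EquivRelPack coxeter_eqb_equiv.

(* The generators being involutions, the monoid presented by the Coxeter
   relations is the group they present. *)
Definition coxeterA : Type := {eq_quot coxeter_equiv}%qT.

HB.instance Definition _ := Choice.on coxeterA.
HB.instance Definition _ := EqQuotient.on coxeterA.

Definition word_class (s : seq 'I_n) : coxeterA := (\pi_coxeterA s)%qT.

Lemma word_classP s t :
  word_class s = word_class t <-> word_cong coxeter_relation s t.
Proof.
split=> [/eqP|st]; first by rewrite /word_class piE => /asboolP.
by apply/eqP; rewrite /word_class piE; apply/asboolP.
Qed.

Definition coxeterA_one : coxeterA := word_class [::].
Definition coxeterA_mul (x y : coxeterA) : coxeterA :=
  word_class (repr x ++ repr y).
Definition coxeterA_inv (x : coxeterA) : coxeterA := word_class (rev (repr x)).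

Lemma repr_class x : word_class (repr x) = x.
Proof. exact: reprK. Qed.

Lemma coxeterA_mulE s t :
  coxeterA_mul (word_class s) (word_class t) = word_class (s ++ t).
Proof.
by apply/word_classP/word_cong_cat2; apply/word_classP; rewrite repr_class.
Qed.

Lemma rev_cancel s : word_cong coxeter_relation (rev s ++ s) [::].
Proof.
elim: s => [|i s IH]; first exact: word_cong_refl.
rewrite rev_cons -cats1 -catA /=; apply: word_cong_trans IH.
exact: (word_cong_step (rev s) s (CoxSquare i)).
Qed.

Lemma coxeterA_mulA : associative coxeterA_mul.
Proof.
move=> x y z; rewrite -[x]repr_class -[y]repr_class -[z]repr_class.
by rewrite !coxeterA_mulE catA.
Qed.

Lemma coxeterA_mul1 : left_id coxeterA_one coxeterA_mul.
Proof. by move=> x; rewrite -[x]repr_class coxeterA_mulE. Qed.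

Lemma coxeterA_mulr1 : right_id coxeterA_one coxeterA_mul.
Proof. by move=> x; rewrite -[x]repr_class coxeterA_mulE cats0. Qed.

Lemma coxeterA_mulV : left_inverse coxeterA_one coxeterA_inv coxeterA_mul.
Proof.
move=> x; rewrite -{2}[x]repr_class coxeterA_mulE.
exact/word_classP/rev_cancel.
Qed.

Lemma coxeterA_mulrV : right_inverse coxeterA_one coxeterA_inv coxeterA_mul.
Proof.
move=> x; rewrite -{1}[x]repr_class coxeterA_mulE.
by apply/word_classP; have := rev_cancel (rev (repr x)); rewrite revK.
Qed.

HB.instance Definition _ := isGroup.Build coxeterA
  coxeterA_mulA coxeterA_mul1 coxeterA_mulr1 coxeterA_mulV coxeterA_mulrV.

Definition sigma (i : 'I_n) : coxeterA := word_class [:: i].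

Definition word_prod (s : seq 'I_n) : coxeterA := (\prod_(i <- s) sigma i)%g.

Lemma word_prodE s : word_prod s = word_class s.
Proof.
rewrite /word_prod; elim: s => [|i s IH]; first by rewrite big_nil.
by rewrite big_cons IH; apply: coxeterA_mulE.
Qed.

Lemma has_expression (w : coxeterA) :
  exists k, `[< exists2 s, size s = k & word_prod s = w >].
Proof.
exists (size (repr w)); apply/asboolP; exists (repr w) => //.
by rewrite word_prodE repr_class.
Qed.

Definition cox_length (w : coxeterA) : nat := ex_minn (has_expression w).

Definition reduced_expression (w : coxeterA) (s : seq 'I_n) : Prop :=
  word_prod s = w /\ size s = cox_length w.

Definition fully_commutative (w : coxeterA) : Prop :=
  forall s t, reduced_expression w s -> reduced_expression w t ->
    word_cong commutation s t.

End CoxeterA.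

Local Open Scope ring_scope.

(* The sum is finite because W(A_n) is; 'X plays the role of q. *)
Definition fc_poincare (n : nat) : {poly int} :=
  \sum_(w \in [set w : coxeterA n | fully_commutative w])
    ('X^(cox_length w) : {poly int}).

(* [b j k] is b_j^k; only the values with 1 <= k <= j are relevant. *)
Definition b_family (b : nat -> nat -> {poly int}) : Prop :=
  [/\ forall j, (1 <= j)%N -> b j j = 1,
      forall j, (2 <= j)%N -> b j 1%N = \prod_(2 <= i < j.+1) (1 - 'X^i)
    & forall j k, (2 <= k)%N -> (k <= j.-1)%N ->
        b j k = b j.-1 k.-1 + (1 - 'X^j) * b j.-1 k - b j.-2 k.-1].

Lemma b_family_unique b b' : b_family b -> b_family b' ->
  forall j k, (1 <= k)%N -> (k <= j)%N -> b j k = b' j k.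
Proof.
move=> [b1 b2 b3] [c1 c2 c3] j; elim/ltn_ind: j => j IH k k1 kj.
have [->|kNj] := eqVneq k j; first by rewrite b1 ?c1 // (leq_trans k1 kj).
have {kNj}kj : (k < j)%N by rewrite ltn_neqAle kNj.
have [k1'|k2] := leqP k 1%N.
  have -> : k = 1%N by apply/eqP; rewrite eqn_leq k1' k1.
  by rewrite b2 ?c2 //; exact: leq_trans kj.
case: j k k1 k2 kj IH => [|[|j]] [|[|k]] // _ _ kj IH.
by rewrite b3 // c3 //= !IH // ltnW.
Qed.

Lemma b_family_exists : exists b, b_family b.
Proof.
pose step (p : (nat -> {poly int}) * (nat -> {poly int})) j k : {poly int} :=
  if k == j then 1 else
  if k == 1%N then \prod_(2 <= i < j.+1) (1 - 'X^i) else
  p.1 k.-1 + (1 - 'X^j) * p.1 k - p.2 k.-1.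
(* [rows j] is the pair of rows j and j - 1. *)
pose fix rows j := if j is j'.+1 then (step (rows j') j, (rows j').1)
                   else (fun=> 0, fun=> 0).
exists (fun j => (rows j).1); split.
- by case=> // j _; rewrite /= /step eqxx.
- by case=> // j j1; rewrite /= /step ifF // ltn_eqF.
- case=> [|[|j]] [|[|k]] // _ kj; rewrite [in LHS]/= /step /= ifF //.
  by rewrite ltn_eqF.
Qed.

(* Infinite matrices with rows and columns indexed by the integers >= 1;
   entries with index 0 are ignored. *)
Definition imatrix := nat -> nat -> {poly int}.

Definition lower_triangular (M : imatrix) : Prop :=
  forall i j, (1 <= i)%N -> (i < j)%N -> M i j = 0.

(* The product for lower triangular M: the terms with k > i vanish. *)
Definition imx_mul (M N : imatrix) : imatrix :=
  fun i j => \sum_(1 <= k < i.+1) M i k * N k j.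

Definition is_imx1 (M : imatrix) : Prop :=
  forall i j, (1 <= i)%N -> (1 <= j)%N -> M i j = (i == j)%:R.

Definition imx_inverse (M N : imatrix) : Prop :=
  [/\ lower_triangular N, is_imx1 (imx_mul M N) & is_imx1 (imx_mul N M)].

Definition P_matrix (b : nat -> nat -> {poly int}) : imatrix :=
  fun i j => if (j <= i)%N then b i j else 0.

Lemma imx_inverse_unique M N N' : (forall i, (1 <= i)%N -> M i i = 1) ->
  imx_inverse M N -> imx_inverse M N' ->
  forall i j, (1 <= i)%N -> (1 <= j)%N -> N i j = N' i j.
Proof.
move=> M1 [_ MN _] [_ MN' _] i j i1 j1; elim/ltn_ind: i i1 => i IH i1.
have := etrans (MN i j i1 j1) (esym (MN' i j i1 j1)).
rewrite /imx_mul !big_nat_recr //= M1 // !mul1r.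
have -> : \sum_(1 <= k < i) M i k * N k j = \sum_(1 <= k < i) M i k * N' k j.
  by apply: eq_big_nat => k /andP[k1 ki]; rewrite IH.
exact: addrI.
Qed.

Lemma imx_inverse_exists M : lower_triangular M ->
  (forall i, (1 <= i)%N -> M i i = 1) -> exists N, imx_inverse M N.
Proof.
move=> Mlt M1.
(* [rows i] holds the rows of index k < i of the inverse, and 0 below them. *)
pose row (r : nat -> nat -> {poly int}) i j : {poly int} :=
  (i == j)%:R - \sum_(1 <= k < i) M i k * r k j.
pose fix rows i := if i is i'.+1 then
  (fun k j => if k == i' then row (rows i') i' j else rows i' k j)
  else (fun _ _ => 0).
have rowsE m k j : (k < m)%N -> rows m k j = rows k.+1 k j.
  elim: m => // m IH; rewrite ltnS leq_eqVlt => /predU1P[->//|km].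
  by rewrite [LHS]/= ltn_eqF // IH.
pose N : imatrix := fun i j => rows i.+1 i j.
have NE i j : N i j = (i == j)%:R - \sum_(1 <= k < i) M i k * N k j.
  rewrite {1}/N /= eqxx /row; congr (_ - _); apply: eq_big_nat => k /andP[_ ki].
  by rewrite rowsE.
have MN : is_imx1 (imx_mul M N).
  move=> i j i1 j1; rewrite /imx_mul big_nat_recr //= M1 // mul1r NE.
  by rewrite addrC subrK.
have Nlt : lower_triangular N.
  move=> i j _; elim/ltn_ind: i => i IH ij.
  rewrite NE ltn_eqF // sub0r big_nat big1 ?oppr0 // => k /andP[_ ki].
  by rewrite IH ?mulr0 // (ltn_trans ki).
exists N; split=> // i j i1 j1.
pose m := maxn i j.
pose A := \matrix_(r < m, s < m) M r.+1 s.+1.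
pose B := \matrix_(r < m, s < m) N r.+1 s.+1.
have sumE (F G : imatrix) (r s : 'I_m) : lower_triangular F ->
    \sum_(k < m) F r.+1 k.+1 * G k.+1 s.+1 = imx_mul F G r.+1 s.+1.
  move=> Flt; rewrite /imx_mul big_add1 /=.
  rewrite -(big_mkord xpredT (fun k => F r.+1 k.+1 * G k.+1 s.+1)).
  rewrite (big_cat_nat (n := r.+1)) //= [X in _ + X]big_nat [X in _ + X]big1 ?addr0 //.
  by move=> k /andP[rk _]; rewrite Flt // mul0r.
have AB : A *m B = 1%:M.
  apply/matrixP => r s; rewrite !mxE; under eq_bigr do rewrite !mxE.
  by rewrite sumE // MN.
have im : (i.-1 < m)%N by rewrite prednK // leq_maxl.
have jm : (j.-1 < m)%N by rewrite prednK // leq_maxr.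
have /matrixP/(_ (Ordinal im) (Ordinal jm)) := mulmx1C AB.
rewrite !mxE; under eq_bigr do rewrite !mxE.
rewrite sumE //= !prednK // => ->.
by rewrite -(inj_eq val_inj) /= -(inj_eq succn_inj) !prednK.
Qed.

Lemma P_matrix_inverse_exists b : b_family b ->
  exists N, imx_inverse (P_matrix b) N.
Proof.
move=> [b1 _ _]; apply: imx_inverse_exists => [i j _ ij|i i1].
  by rewrite /P_matrix leqNgt ij.
by rewrite /P_matrix leqnn b1.
Qed.

Lemma fc_poincare0 : fc_poincare 0 = 1.
Proof.
have nil0 (s : seq 'I_0) : s = [::] by case: s => // -[].
have W0 (w : coxeterA 0) : w = word_class [::].
  by rewrite -[w]repr_class [repr w]nil0.
have l0 (w : coxeterA 0) : cox_length w = 0%N.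
  rewrite /cox_length; case: ex_minnP => k /asboolP[s <- _] _.
  by rewrite (nil0 s).
rewrite /fc_poincare (_ : [set w | _] = [set word_class [::]])%classic.
  by rewrite fsbig_set1 l0 expr0.
apply/seteqP; split=> w /= _; first exact: W0.
by move=> s t _ _; rewrite (nil0 s) (nil0 t); apply: word_cong_refl.
Qed.

(* Main.v *)
Require Import Defs.
From mathcomp Require Import all_boot all_order all_algebra.
From mathcomp Require Import zify ring.
From mathcomp Require Import boolp classical_sets functions fsbigop.

Local Open Scope ring_scope.

(** Rows and columns are indexed from 0 below, and q is 'X.

The recursion for the b_j^k says exactly that multiplication by P turns the
shift w |-> w(. + 1) into a simple operator M on sequences, [inverse_step]:
  (M v)(i) = v(i+1) - v(0) + sum_(j <= i) q^(j+2) v(j)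
([inverse_step_b_transform]).  If w is the first column of P^-1, then P w is
the unit sequence e_0, so w(n) = (P (shift^n w))(0) = (M^n e_0)(0): the entries
to be computed are iterates of M, and the inverse never has to be constructed
([first_column_iter]).

On the other side, every fully commutative element of W(A_n) has a unique
normal form, a product of decreasing runs
  sigma_(j+e) ... sigma_(j+1) sigma_j
whose first and last letters both increase from run to run.  Removing the last
run shows that the generating function of the normal forms with all j < t and
all j + e < t + d is (C^t 1)(d), where
  (C v)(d) = v(d+1) + sum_(j <= d) q^(j+1) v(j)
is [count_step]; hence a_n = (C^n 1)(0) ([fc_poincareE]).

The two operators are intertwined by (N v)(i) = sum_(j <= i) q^(j+2) v(j),
namely M N = N (q C) ([inverse_step_weighted_sum]).  Since M e_0 = (q^2 - 1) 1
and M 1 = N 1, it follows that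
  M^(n+2) e_0 = (q^2 - 1) N ((q C)^n 1),
whose value at 0 is (q^2 - 1) q^2 q^n a_n.

The normal form theorem is obtained from the action of words on the natural
numbers by adjacent transpositions.  Let D(s) be the sum of max(s.x - x, 0)
over x.  This is subadditive for concatenation and bounded by the length of s,
and it is strictly smaller than the length for the words ii and iji with i, j
adjacent ([up_displacement_reducible]), while it equals the length for normal
forms ([staircase_up_displacement]).  So a normal form is reduced, and every
reduced expression of the same element also attains the bound, hence contains
no factor ii or iji up to commutations.  Conversely any word without such
factors can be brought to normal form by commutations alone
([factor_free_staircase]), and the normal form is determined by its action
([staircase_act_inj]); this gives full commutativity, existence and uniqueness
at once. *)

Set Implicit Arguments.
Unset Strict Implicit.
Unset Printing Implicit Defensive.

Import GRing.Theory.

(** * The inverse matrix as an iterated operator *)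

Definition inverse_step (v : nat -> {poly int}) (i : nat) : {poly int} :=
  v i.+1 - v 0%N + \sum_(j < i.+1) 'X^(j.+2) * v j.

Definition count_step (v : nat -> {poly int}) (d : nat) : {poly int} :=
  v d.+1 + \sum_(j < d.+1) 'X^(j.+1) * v j.

Definition weighted_sum (v : nat -> {poly int}) (i : nat) : {poly int} :=
  \sum_(j < i.+1) 'X^(j.+2) * v j.

(** Both sides agree at 0 and have the same differences
    q^(i+4) v(i+2) + q^(i+3) sum_(j <= i+1) q^(j+2) v(j). *)
Lemma inverse_step_weighted_sum v :
  inverse_step (weighted_sum v) = weighted_sum (fun d => 'X * count_step v d).
Proof.
apply/funext; elim=> [|i IH].
  rewrite /inverse_step /weighted_sum /count_step !big_ord_recr !big_ord0 /=.
  ring.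
rewrite [RHS]/weighted_sum big_ord_recr /=.
rewrite -[X in X + _ * _]/(weighted_sum (fun d => 'X * count_step v d) i) -IH.
rewrite /inverse_step [X in _ - _ + X]big_ord_recr /=.
have wS k : weighted_sum v k.+1 = weighted_sum v k + 'X^(k.+3) * v k.+1.
  by rewrite /weighted_sum big_ord_recr.
rewrite !wS /count_step.
have -> : \sum_(j < i.+2) 'X^(j.+1) * v j
     = \sum_(j < i.+1) 'X^(j.+1) * v j + 'X^(i.+2) * v i.+1.
  by rewrite big_ord_recr.
have -> : weighted_sum v i = 'X * \sum_(j < i.+1) 'X^(j.+1) * v j.
  rewrite /weighted_sum mulr_sumr; apply: eq_bigr => j _.
  by rewrite mulrA -exprS.
rewrite !exprS.
ring.
Qed.

Lemma inverse_stepZ a v :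
  inverse_step (fun i => a * v i) = (fun i => a * inverse_step v i).
Proof.
apply/funext=> i; rewrite /inverse_step !mulrDr mulrN mulr_sumr.
by under eq_bigr do rewrite mulrCA.
Qed.

Lemma iter_inverse_stepZ n a v :
  iter n inverse_step (fun i => a * v i) = (fun i => a * iter n inverse_step v i).
Proof. by elim: n => //= n ->; rewrite inverse_stepZ. Qed.

Lemma count_stepZ a v :
  count_step (fun i => a * v i) = (fun i => a * count_step v i).
Proof.
apply/funext=> i; rewrite /count_step !mulrDr mulr_sumr.
by under eq_bigr do rewrite mulrCA.
Qed.

Lemma iter_inverse_step_weighted_sum n v :
  iter n inverse_step (weighted_sum v) =
  weighted_sum (fun d => 'X^n * iter n count_step v d).
Proof.
elim: n => [|n IH] /=; first by congr weighted_sum; apply/funext=> d; rewrite mul1r.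
rewrite IH inverse_step_weighted_sum; congr weighted_sum; apply/funext=> d.
by rewrite count_stepZ mulrA -exprS.
Qed.

Lemma inverse_step_delta :
  inverse_step (fun i => (i == 0%N)%:R) = (fun=> ('X^2 - 1) * 1).
Proof.
apply/funext=> i; rewrite /inverse_step big_ord_recl big1 /= => [|j _].
  by ring.
by rewrite mulr0.
Qed.

Lemma inverse_step_one : inverse_step (fun=> 1) = weighted_sum (fun=> 1).
Proof. by apply/funext=> i; rewrite /inverse_step subrr add0r. Qed.

Lemma iter_inverse_step_delta n :
  iter n.+2 inverse_step (fun i => (i == 0%N)%:R) 0%N =
  - (1 - 'X^2) * 'X^(n.+2) * iter n count_step (fun=> 1) 0%N.
Proof.
rewrite !iterSr inverse_step_delta inverse_stepZ inverse_step_one.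
rewrite iter_inverse_stepZ iter_inverse_step_weighted_sum /weighted_sum.
rewrite big_ord1 !exprS; ring.
Qed.

Section Matrix.
Variables (b : nat -> nat -> {poly int}) (hb : b_family b).

Definition b_transform (w : nat -> {poly int}) (i : nat) : {poly int} :=
  \sum_(k < i.+1) b i.+1 k.+1 * w k.

(** The instance k = 1 of the recursion of the b_j^k, with b_j^0 = 0. *)
Lemma b_column1 i : b i.+2 1 = (1 - 'X^(i.+2)) * b i.+1 1.
Proof.
case: hb => b1 b2 _; rewrite b2 // big_nat_recr //= mulrC; congr (_ * _).
by case: i => [|i]; [rewrite b1 // big_geq | rewrite b2].
Qed.

Lemma b_transformS w i :
  b_transform w i.+1 = (1 - 'X^(i.+2)) * b_transform w i +
    b_transform (w \o succn) i
    - \sum_(k < i) b i k.+1 * w k.+1.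
Proof.
case: hb => b1 _ b3.
rewrite /b_transform big_ord_recl big_ord_recr /=.
rewrite [in RHS]big_ord_recl [X in _ + X - _]big_ord_recr /=.
rewrite b_column1 !b1 // mulrDr mulrA mulr_sumr.
under eq_bigr => k _ do
  rewrite /bump /= add1n (b3 i.+2 k.+2 isT (ltn_ord k)) /=.
set A := \sum_(k < i) b i k.+1 * _.
set B := \sum_(k < i) b i.+1 k.+1 * _.
set C := \sum_(k < i) (1 - _) * _.
suff -> : \sum_(k < i) (b i.+1 k.+1 + (1 - 'X^(i.+2)) * b i.+1 k.+2 - b i k.+1)
     * w k.+1 = B + C - A by ring.
rewrite /A /B /C -big_split -sumrB /=; apply: eq_bigr => k _.
rewrite /bump /= add1n; ring.
Qed.

(** Taking the difference of two consecutive entries turns [inverse_step] into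
    v(i+2) - (1 - q^(i+3)) v(i+1).  For v = P w the recursion rewrites this as
    (P w')(i+1) - (P w')(i), where w' is the shift of w. *)
Lemma inverse_step_b_transform w :
  inverse_step (b_transform w) = b_transform (w \o succn).
Proof.
apply/funext; elim=> [|i IH].
  rewrite /inverse_step b_transformS big_ord0 big_ord1; ring.
rewrite /inverse_step big_ord_recr /=.
have -> : \sum_(j < i.+1) 'X^(j.+2) * b_transform w j
   = b_transform (w \o succn) i - (b_transform w i.+1 - b_transform w 0%N).
  by rewrite -IH /inverse_step; ring.
rewrite b_transformS [b_transform (w \o succn) i]/b_transform /=.
ring.
Qed.

Lemma first_column_iter (Pinv : nat -> nat -> {poly int}) n :
  imx_inverse (P_matrix b) Pinv ->
  Pinv n.+1 1 = iter n inverse_step (fun i => (i == 0%N)%:R) 0%N.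
Proof.
case=> _ PQ _; case: (hb) => b1 _ _.
have -> : (fun i => (i == 0%N)%:R) = b_transform (fun k => Pinv k.+1 1%N).
  apply/funext=> i; have := PQ i.+1 1%N isT isT; rewrite eqSS => <-.
  rewrite /imx_mul big_add1 big_mkord; apply: eq_bigr => k _.
  by rewrite /P_matrix ltn_ord.
have iterE w : iter n inverse_step (b_transform w) = b_transform (fun k => w (k + n)%N).
  elim: n => [|n IH] /=; first by congr b_transform; apply/funext=> k; rewrite addn0.
  rewrite IH inverse_step_b_transform; congr b_transform; apply/funext=> k.
  by rewrite /= addSnnS.
by rewrite iterE /b_transform big_ord1 b1 // mul1r.
Qed.

End Matrix.

(** * Commutation classes of words over the natural numbers *)

Local Open Scope nat_scope.

(** Words here have natural numbers as letters, so that runs and their bounds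
    are plain arithmetic; [map val] and [restrict_word] translate from and to
    words over 'I_n. *)
Inductive far_swap : seq nat -> seq nat -> Prop :=
| FarSwap i j : (i.+2 <= j) || (j.+2 <= i) -> far_swap [:: i; j] [:: j; i].

Notation comm := (word_cong far_swap).

Lemma comm_perm s t : comm s t -> perm_eq s t.
Proof.
elim=> {s t} [u v _ _ [i j _]|s|s t _|s t r _ st _ tr] //.
- by rewrite perm_cat2l perm_cat2r -[[:: i; j]]/([:: i] ++ [:: j]) perm_catC.
- by rewrite perm_sym.
- exact: perm_trans st tr.
Qed.

Lemma comm_move c s :
  all (fun i => (c.+2 <= i) || (i.+2 <= c)) s -> comm (c :: s) (rcons s c).
Proof.
elim: s => [|i s IH] /=; first by move=> _; apply: word_cong_refl.
move=> /andP[ci /IH cs].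
apply: (word_cong_trans (t := i :: c :: s)).
  exact: (word_cong_step [::] s (FarSwap ci)).
by have := word_cong_cat [:: i] [::] cs; rewrite !cats0.
Qed.

(** * Words acting on the natural numbers *)

Definition swap (i x : nat) : nat :=
  if x == i then i.+1 else if x == i.+1 then i else x.

Definition word_act (s : seq nat) (x : nat) : nat := foldr swap x s.

Lemma word_act_cat s t x : word_act (s ++ t) x = word_act s (word_act t x).
Proof. exact: foldr_cat. Qed.

Lemma swapK i : involutive (swap i).
Proof. by move=> x; rewrite /swap; do ! case: eqP => //=; lia. Qed.

Lemma word_act_revK s x : word_act (rev s) (word_act s x) = x.
Proof.
elim: s x => //= i s IH x.
by rewrite rev_cons -cats1 word_act_cat /= swapK.
Qed.

Lemma word_act_revKV s x : word_act s (word_act (rev s) x) = x.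
Proof. by rewrite -{1}[s]revK word_act_revK. Qed.

Lemma word_act_inj s : injective (word_act s).
Proof. exact: can_inj (word_act_revK s). Qed.

Lemma word_act_far i j x : (i.+2 <= j) || (j.+2 <= i) ->
  word_act [:: i; j] x = word_act [:: j; i] x.
Proof. by move=> ij; rewrite /= /swap; do ! case: eqP => //=; lia. Qed.

Lemma word_act_comm s t : comm s t -> word_act s =1 word_act t.
Proof.
elim=> {s t} [u v _ _ [i j ij]|s|s t _|s t r _ st _ tr] // x.
- by rewrite !word_act_cat word_act_far.
- by [].
- by rewrite st tr.
Qed.

Lemma word_act_ltn n s x :
  all (fun i => i < n) s -> x < n.+1 -> word_act s x < n.+1.
Proof.
move=> + xn; elim: s => //= i s IH /andP[i_n /IH].
by rewrite /swap; do ! case: eqP => //=; lia.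
Qed.

Lemma word_act_perm n s : all (fun i => i < n) s ->
  perm_eq (map (word_act s) (iota 0 n.+1)) (iota 0 n.+1).
Proof.
move=> s_n; have us : uniq (map (word_act s) (iota 0 n.+1)).
  by rewrite map_inj_uniq ?iota_uniq //; exact: word_act_inj.
apply: uniq_perm => //; first exact: iota_uniq.
apply: (uniq_min_size us _ _).2; last by rewrite size_map.
move=> _ /mapP[x + ->]; rewrite !mem_iota /= add0n; exact: word_act_ltn.
Qed.

(** For a permutation of 0, ..., n, half of the total displacement, because
    upward and downward moves have the same sum. *)
Definition up_displacement (n : nat) (s : seq nat) : nat :=
  \sum_(x <- iota 0 n.+1) (word_act s x - x).

(** Pointwise this is the triangle inequality for the truncated difference; the
    first term must be reindexed along the permutation given by t. *)
Lemma up_displacement_cat n s t : all (fun i => i < n) t ->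
  up_displacement n (s ++ t) <= up_displacement n s + up_displacement n t.
Proof.
move=> t_n; rewrite /up_displacement.
rewrite -[X in _ <= X + _](perm_big _ (word_act_perm t_n)) big_map -big_split /=.
by apply: leq_sum => x _; rewrite word_act_cat; lia.
Qed.

Lemma sum_indicator n a : \sum_(x <- iota 0 n) (x == a) = (a < n).
Proof.
transitivity (count_mem a (iota 0 n)).
  elim: (iota 0 n) => [|x s IH] /=; first by rewrite big_nil.
  by rewrite big_cons IH.
by rewrite count_uniq_mem ?iota_uniq // mem_iota.
Qed.

Lemma up_displacement_letter n i : up_displacement n [:: i] <= 1.
Proof.
apply: (@leq_trans (\sum_(x <- iota 0 n.+1) (x == i))).
  by apply: leq_sum => x _; rewrite /= /swap; do ! case: eqP => //=; lia.
by rewrite sum_indicator leq_b1.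
Qed.

Lemma up_displacement_size n s : all (fun i => i < n) s -> up_displacement n s <= size s.
Proof.
elim: s => [|i s IH] /=; first by rewrite /up_displacement big1 // => x _; rewrite subnn.
move=> /andP[_ s_n]; rewrite -cat1s.
apply: leq_trans (up_displacement_cat _ s_n) _.
by rewrite -add1n leq_add ?up_displacement_letter ?IH.
Qed.

Inductive reducible_factor : seq nat -> Prop :=
| SquareFactor i : reducible_factor [:: i; i]
| BraidFactor i j : (i == j.+1) || (j == i.+1) -> reducible_factor [:: i; j; i].

(** The word ii acts trivially, and iji exchanges min(i, j) and min(i, j) + 2,
    so it moves a single point upwards, by 2. *)
Lemma up_displacement_reducible n f :
  reducible_factor f -> up_displacement n f < size f.
Proof.
case=> [i|i j ij] /=.
  by rewrite /up_displacement big1 // => x _; rewrite /= swapK subnn.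
apply: (@leq_ltn_trans (\sum_(x <- iota 0 n.+1) ((x == minn i j) + (x == minn i j)))).
  by apply: leq_sum => x _; rewrite /= /swap; do ! case: eqP => //=; lia.
rewrite big_split !sum_indicator; by case: (minn i j < _).
Qed.

Definition factor_free (s : seq nat) : Prop :=
  forall p f r, reducible_factor f -> ~ comm s (p ++ f ++ r).

(** A factor whose displacement falls short of its length would make the whole
    word fall short, by subadditivity. *)
Lemma tight_factor_free n s : all (fun i => i < n) s ->
  up_displacement n s = size s -> factor_free s.
Proof.
move=> s_n s_tight p f r f_red sC.
have /perm_all pA := comm_perm sC.
have s_size : size s = size p + (size f + size r).
  by rewrite (perm_size (comm_perm sC)) !size_cat.
move: s_n; rewrite pA !all_cat => /and3P[p_n f_n r_n].
have : up_displacement n (p ++ f ++ r) = size s.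
  by rewrite -s_tight; apply: eq_bigr => x _; rewrite (word_act_comm sC).
have := @up_displacement_cat n p (f ++ r); rewrite all_cat f_n r_n => /(_ isT).
have := @up_displacement_cat n f r r_n.
have := up_displacement_size p_n; have := up_displacement_size r_n.
have := up_displacement_reducible n f_red.
lia.
Qed.

(** * Normal forms *)

(** The decreasing word j+e, ..., j+1, j. *)
Fixpoint run (j e : nat) : seq nat :=
  if e is e'.+1 then j + e :: run j e' else [:: j].

(** A normal form is a list of pairs (j, e) standing for runs, the last run
    coming first, since words are extended and analysed at their right end.
    Both j and j + e decrease strictly along the list, starting below t and m. *)
Fixpoint staircase (t m : nat) (l : seq (nat * nat)) : bool :=
  if l is (j, e) :: l' then [&& j < t, j + e < m & staircase j (j + e) l'] else true.

Fixpoint staircase_word (l : seq (nat * nat)) : seq nat :=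
  if l is (j, e) :: l' then staircase_word l' ++ run j e else [::].

Lemma run_cat j e f : run j (e + f.+1) = run (j + f.+1) e ++ run j f.
Proof. by elim: e => [|e IH] //=; rewrite IH -addnA (addnC f.+1) addSn. Qed.

Lemma run_rcons c e : run c e.+1 = rcons (run c.+1 e) c.
Proof. by rewrite -addn1 run_cat addn1 cats1. Qed.

Lemma run_last j e : exists p, run j e = rcons p j.
Proof. by case: e => [|e]; [exists [::] | exists (run j.+1 e); rewrite run_rcons]. Qed.

Lemma size_run j e : size (run j e) = e.+1.
Proof. by elim: e => //= e ->. Qed.

Lemma mem_run j e x : (x \in run j e) = (j <= x <= j + e).
Proof. by elim: e => [|e IH] /=; rewrite inE ?IH; lia. Qed.

Lemma run_act j e x : word_act (run j e) x =
  if x == j then (j + e).+1 else if j < x <= (j + e).+1 then x.-1 else x.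
Proof.
elim: e => [|e IH] /=.
  by rewrite /swap; do ! case: ifP => //=; lia.
by rewrite IH /swap; do ! case: ifP => //=; lia.
Qed.

Lemma staircase_wider t m t' m' l :
  t <= t' -> m <= m' -> staircase t m l -> staircase t' m' l.
Proof.
case: l => [|[j e] l] //= tt' mm' /and3P[jt jm ->].
by rewrite (leq_trans jt) // (leq_trans jm).
Qed.

Lemma staircase_letters t m l :
  staircase t m l -> all (fun i => i < m) (staircase_word l).
Proof.
elim: l t m => [|[j e] l IH] t m //= /and3P[jt jm /IH lm].
rewrite all_cat; apply/andP; split.
  by apply: sub_all lm => i /= ij; exact: ltn_trans ij jm.
by apply/allP=> i; rewrite mem_run => /andP[_ ij]; apply: leq_ltn_trans jm.
Qed.

(** A point x beyond all the last letters j is only ever moved down: the run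
    (j, e) sends x in ]j, j+e+1] to x - 1, and x - 1 >= j lies beyond the last
    letters of the remaining runs. *)
Lemma staircase_act_le t m l x :
  staircase t m l -> t <= x -> word_act (staircase_word l) x <= x.
Proof.
elim: l t m x => [|[j e] l IH] t m x //= /and3P[jt jm lj] tx.
rewrite word_act_cat run_act; case: ifP => [/eqP xj|_]; first by lia.
case: ifP => [/andP[jx _]|_]; last by apply: IH lj _; lia.
by apply: leq_trans (IH _ _ _ lj _) _; lia.
Qed.

Lemma word_act_fixed m s x :
  all (fun i => i < m) s -> m < x -> word_act s x = x.
Proof.
move=> + mx; elim: s => //= i s IH /andP[im /IH ->].
by rewrite /swap; do ! case: eqP => //=; lia.
Qed.

(** The run (j, e) lifts j to j + e + 1, which is out of reach of the letters of
    the other runs. *)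
Lemma staircase_act_head t m j e l : staircase t m ((j, e) :: l) ->
  word_act (staircase_word ((j, e) :: l)) j = (j + e).+1.
Proof.
move=> /= /and3P[_ _ /staircase_letters lj].
by rewrite word_act_cat run_act eqxx (word_act_fixed lj).
Qed.

(** Prepending a pair (j, e) to the list adds e + 1 to the contribution of the
    point j and leaves all other contributions unchanged. *)
Lemma staircase_up_displacement n l : staircase n n l ->
  up_displacement n (staircase_word l) = size (staircase_word l).
Proof.
move=> ln; suff dE t m k : m <= n -> staircase t m k ->
    up_displacement n (staircase_word k) = size (staircase_word k).
  exact: dE ln.
elim: k t m => [|[j e] k IH] t m mn.
  by move=> _; rewrite /up_displacement big1 // => x _; rewrite subnn.
move=> kt; have hd := staircase_act_head kt.
move: kt => /= /and3P[jt jm kj].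
rewrite size_cat size_run -(IH _ _ _ kj); last by lia.
have -> : e.+1 = \sum_(x <- iota 0 n.+1) (x == j) * e.+1.
  rewrite -big_distrl sum_indicator /=; have -> : j < n.+1 by lia.
  by rewrite mul1n.
rewrite -big_split /=; apply: eq_bigr => x _.
have [->|xj] := eqVneq x j.
  by rewrite hd; have := staircase_act_le kj (leqnn j); lia.
rewrite word_act_cat run_act (negPf xj) mul0n addn0.
case: ifP => // /andP[jx xje].
have := @staircase_act_le _ _ _ x kj; have := @staircase_act_le _ _ _ x.-1 kj.
lia.
Qed.

(** The last run can be read off the action: j is the largest point that is
    moved up, and its image is j + e + 1. *)
Lemma staircase_act_inj t m t' m' l l' :
  staircase t m l -> staircase t' m' l' ->
  word_act (staircase_word l) =1 word_act (staircase_word l') -> l = l'.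
Proof.
elim: l t m t' m' l' => [|[j e] l IH] t m t' m' [|[j' e'] l'] // lt lt' E.
- by have := E j'; rewrite (staircase_act_head lt') /=; lia.
- by have := E j; rewrite (staircase_act_head lt) /=; lia.
have hd := staircase_act_head lt; have hd' := staircase_act_head lt'.
have le x : j < x -> word_act (staircase_word ((j, e) :: l)) x <= x.
  by apply: (@staircase_act_le j.+1 m); move: lt => /= /and3P[_ -> ->]; rewrite leqnn.
have le' x : j' < x -> word_act (staircase_word ((j', e') :: l')) x <= x.
  by apply: (@staircase_act_le j'.+1 m'); move: lt' => /= /and3P[_ -> ->]; rewrite leqnn.
have jj' : j = j'.
  have := le j'; have := le' j; rewrite E hd' -E hd; lia.
have ee' : e = e' by have := E j; rewrite hd jj' hd'; lia.
subst j' e'; congr (_ :: _).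
move: lt lt' => /= /and3P[_ _ lj] /and3P[_ _ lj'].
apply: IH lj lj' _ => x.
have := E (word_act (rev (run j e)) x).
by rewrite /= !word_act_cat !word_act_revKV.
Qed.

Lemma factor_free_comm s t : comm s t -> factor_free s -> factor_free t.
Proof.
move=> st fs p f r f_red tC; exact: fs f_red (word_cong_trans st tC).
Qed.

Lemma factor_free_prefix s t : factor_free (s ++ t) -> factor_free s.
Proof.
move=> fs p f r f_red sC; apply: (fs p f (r ++ t) f_red).
by have := word_cong_cat [::] t sC; rewrite -!catA.
Qed.

(** A letter c written after a normal form whose last run is j+e, ..., j can be
    absorbed: it starts a new run if c > j + e, prolongs the last run if
    c = j - 1, and commutes with the whole last run if c < j - 1.  For c in the
    run, or for c = j - 1 when the preceding run already ends with c, a factor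
    ii or iji appears.  Keeping the bounds t and m in the conclusion is what lets
    the induction put the last run back. *)
Lemma insert_letter t m l c : staircase t m l -> c < t -> c < m ->
  factor_free (rcons (staircase_word l) c) ->
  exists2 l', staircase t m l' &
    comm (rcons (staircase_word l) c) (staircase_word l').
Proof.
elim: l t m => [|[j e] l IH] t m.
  move=> _ ct cm _; exists [:: (c, 0)]; first by rewrite /= ct addn0 cm.
  exact: word_cong_refl.
move=> lt ct cm fl; have [jec|cje] := ltnP (j + e) c.
  exists ((c, 0) :: (j, e) :: l).
    by move: lt => /= /and3P[_ _ ->]; rewrite ct addn0 cm jec; lia.
  by rewrite -cats1; exact: word_cong_refl.
move: lt => /= /and3P[jt jm lj].
have [jc|cj|cj] := ltngtP j c.
(* The run contains c and c - 1; the final c moves left past the letters below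
   c - 1, which gives the factor c, c - 1, c. *)
- exfalso; set s := staircase_word l in fl.
  pose f := c - j.+1; pose g := j + e - c.
  have [p rp] := run_last c g.
  have ejE : e = g + f.+1 by rewrite /g /f; lia.
  have jfc : j + f.+1 = c by rewrite /f; lia.
  have rE : run j e = p ++ [:: c] ++ run j f by rewrite ejE run_cat jfc rp -cats1 -catA.
  have [r rfE rfar] : exists2 r, run j f = c.-1 :: r &
      all (fun i => (c.+2 <= i) || (i.+2 <= c)) r.
    case: (f) jfc => [|f'] jfc /=; first by exists [::] => //; congr [:: _]; lia.
    exists (run j f'); first by congr (_ :: _); lia.
    by apply/allP=> i; rewrite mem_run; lia.
  apply: (fl (s ++ p) [:: c; c.-1; c] r); first by apply: BraidFactor; lia.
  rewrite -cats1 /= rE rfE -!catA /=.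
  have := word_cong_sym (comm_move rfar); rewrite -cats1 => rC.
  have := word_cong_cat (s ++ p ++ [:: c; c.-1]) [::] rC.
  by rewrite -!catA /= !cats0.
- have [cj'|cj'] := eqVneq j c.+1.
    case: (boolP (staircase c (c + e.+1) l)) => lc.
      exists ((c, e.+1) :: l); first by rewrite /= ct lc; lia.
      rewrite [staircase_word (_ :: l)]/(staircase_word l ++ run c e.+1).
      rewrite run_rcons -cj' /= rcons_cat; exact: word_cong_refl.
    (* The preceding run ends with c, which moves right to the c + 1 that ends
       the last run: this gives the factor c, c + 1, c. *)
    exfalso; case: l lj lc fl {IH} => [|[j' e'] l] //= /and3P[j'j j'e' lj'].
    rewrite lj' => lc; have -> : j' = c by lia.
    set s := staircase_word l => fl; have [p rp] := run_last c e'.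
    have [r rE rfar] : exists2 r, run j e = rcons r c.+1 &
        all (fun i => (c.+2 <= i) || (i.+2 <= c)) r.
      rewrite cj'; case: (e) => [|e2]; first by exists [::].
      exists (run c.+2 e2); first by rewrite run_rcons.
      by apply/allP=> i; rewrite mem_run; lia.
    apply: (fl (s ++ p ++ r) [:: c; c.+1; c] [::]).
      by apply: BraidFactor; rewrite eqxx orbT.
    have := comm_move rfar; rewrite -[rcons r c]cats1 => rC.
    have := word_cong_cat (s ++ p) [:: c.+1; c] rC.
    by rewrite rp rE -!cats1 -!catA /=.
  have cfar : all (fun i => (c.+2 <= i) || (i.+2 <= c)) (run j e).
    by apply/allP=> i; rewrite mem_run; lia.
  have cC : comm (rcons (staircase_word l ++ run j e) c)
                 (rcons (staircase_word l) c ++ run j e).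
    have := word_cong_cat (staircase_word l) [::] (word_cong_sym (comm_move cfar)).
    by rewrite !cats0 -rcons_cat cat_rcons.
  have [|||l' l'j l'C] := IH _ _ lj; [lia | lia | |].
    by apply: (@factor_free_prefix _ (run j e)); apply: factor_free_comm cC fl.
  exists ((j, e) :: l'); first by rewrite /= jt jm.
  apply: word_cong_trans cC _.
  exact: (word_cong_cat [::] (run j e) l'C).
- exfalso; have [p rp] := run_last j e.
  apply: (fl (staircase_word l ++ p) [:: c; c] [::]); first exact: SquareFactor.
  rewrite /= rp cj -!cats1 -!catA /=; exact: word_cong_refl.
Qed.

Lemma factor_free_staircase n s : all (fun i => i < n) s -> factor_free s ->
  exists2 l, staircase n n l & comm s (staircase_word l).
Proof.
elim/last_ind: s => [|s c IH]; first by exists [::] => //; apply: word_cong_refl.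
rewrite all_rcons => /andP[cn s_n] fs.
have [|l ln lC] := IH s_n.
  by apply: (@factor_free_prefix _ [:: c]); rewrite cats1.
have sC : comm (rcons s c) (rcons (staircase_word l) c).
  by rewrite -!cats1; exact: (word_cong_cat [::] [:: c] lC).
have [l' l'n l'C] := insert_letter ln cn cn (factor_free_comm sC fs).
by exists l' => //; exact: word_cong_trans sC l'C.
Qed.

(** * Enumeration of the normal forms *)

(** The normal forms with bounds t and t + d, according to whether the bound
    t - 1 is attained by the last letter of the last run. *)
Fixpoint staircases (t d : nat) : seq (seq (nat * nat)) :=
  if t is t'.+1 then
    staircases t' d.+1 ++
    [seq (t', e) :: l | e <- iota 0 d.+1, l <- staircases t' e]
  else [:: [::]].

Lemma staircasesS t d : staircases t.+1 d =
  staircases t d.+1 ++ [seq (t, e) :: l | e <- iota 0 d.+1, l <- staircases t e].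
Proof. by []. Qed.

Lemma mem_staircases t d l : (l \in staircases t d) = staircase t (t + d) l.
Proof.
elim: t d l => [|t IH] d l; first by case: l => [|[]].
rewrite staircasesS mem_cat IH; apply/orP/idP => [[lt|/allpairsPdep[e [k [+ + ->]]]]|].
- by apply: staircase_wider lt => //; lia.
- by rewrite mem_iota IH => ed kt /=; rewrite kt; lia.
case: l => [|[j e] l]; first by left.
case/and3P=> jt jd; rewrite -/staircase => lj; have [jt'|tj] := ltnP j t.
  by left; rewrite /= lj; lia.
right; have tE : j = t by lia.
apply/allpairsPdep; exists e, l; rewrite mem_iota IH -tE lj; split=> //; lia.
Qed.

Lemma staircases_uniq t d : uniq (staircases t d).
Proof.
elim: t d => // t IH d; rewrite staircasesS cat_uniq IH andTb; apply/andP; split.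
  apply/hasPn=> _ /allpairsPdep[e [k [_ _ ->]]].
  by rewrite mem_staircases /= ltnn.
apply: allpairs_uniq_dep => [||[e k] [e' k'] _ _ [-> ->]] //; exact: iota_uniq.
Qed.

Local Open Scope ring_scope.

Lemma staircases_weight t d :
  \sum_(l <- staircases t d) 'X^(size (staircase_word l)) =
  iter t count_step (fun=> 1) d :> {poly int}.
Proof.
elim: t d => [|t IH] d; first by rewrite /= big_seq1 expr0.
rewrite iterS /count_step -IH staircasesS big_cat; congr (_ + _).
rewrite big_allpairs_dep -(big_mkord xpredT (fun e => 'X^(e.+1) * iter t count_step (fun=> 1) e)).
rewrite /index_iota subn0; apply: eq_bigr => e _.
rewrite -IH mulr_sumr; apply: eq_bigr => l _.
by rewrite /= size_cat size_run addnC exprD.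
Qed.

Local Open Scope nat_scope.

(** * Fully commutative elements of the Coxeter group *)

Section FullyCommutative.
Variable n : nat.

Lemma word_act_coxeter (s t : seq 'I_n) : word_cong (@coxeter_relation n) s t ->
  word_act (map val s) =1 word_act (map val t).
Proof.
elim=> {s t} [u v s t st|s|s t _|s t r _ st _ tr] //.
- move=> x; rewrite !map_cat !word_act_cat; congr (word_act _ _).
  case: st => [i|i j ij|_ _ [i j ij]].
  + by rewrite /= swapK.
  + by rewrite /= ij /swap; do ! case: eqP => //=; lia.
  + exact: word_act_far.
- by move=> st x; rewrite st.
- by move=> x; rewrite st tr.
Qed.

Lemma comm_map_val (s t : seq 'I_n) :
  word_cong (@commutation n) s t -> comm (map val s) (map val t).
Proof.
elim=> {s t} [u v _ _ [i j ij]|s|s t _|s t r _ st _ tr].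
- rewrite !map_cat; exact: word_cong_step (FarSwap ij).
- exact: word_cong_refl.
- exact: word_cong_sym.
- exact: word_cong_trans st tr.
Qed.

(** Dropping the letters outside 'I_n makes this a total morphism of monoids, so
    that it maps commutations to commutations without a side condition. *)
Definition restrict_word (s : seq nat) : seq 'I_n := pmap insub s.

Lemma comm_restrict_word (s t : seq nat) :
  comm s t -> word_cong (@commutation n) (restrict_word s) (restrict_word t).
Proof.
elim=> {s t} [u v _ _ [i j ij]|s|s t _|s t r _ st _ tr].
- rewrite /restrict_word !pmap_cat /=.
  case: (insubP _ i) => [i' _ iE|_] /=; case: (insubP _ j) => [j' _ jE|_] /=;
    try exact: word_cong_refl.
  have ij' : (i'.+2 <= j') || (j'.+2 <= i').
    by move: ij; rewrite -iE -jE.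
  exact: (word_cong_step (pmap insub u) (pmap insub v) (Commutation ij')).
- exact: word_cong_refl.
- exact: word_cong_sym.
- exact: word_cong_trans st tr.
Qed.

Lemma map_valK : cancel (map val) restrict_word.
Proof. exact: map_pK valK. Qed.

Lemma restrict_wordK (s : seq nat) :
  all (fun i => i < n) s -> map val (restrict_word s) = s.
Proof.
move=> s_n; rewrite /restrict_word (pmap_filter (insubK _)).
by apply/all_filterP; apply: sub_all s_n => i /= i_n; rewrite insubT.
Qed.

Lemma map_val_ltn (s : seq 'I_n) : all (fun i => i < n) (map val s).
Proof. by apply/allP => _ /mapP[i _ ->]; exact: ltn_ord. Qed.

Lemma word_prod_eq (s t : seq 'I_n) :
  word_prod s = word_prod t <-> word_cong (@coxeter_relation n) s t.
Proof. by rewrite !word_prodE; exact: word_classP. Qed.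

Lemma commutation_coxeter (s t : seq 'I_n) :
  word_cong (@commutation n) s t -> word_cong (@coxeter_relation n) s t.
Proof.
elim=> {s t} [u v s t st|s|s t _|s t r _ st _ tr].
- exact: word_cong_step (CoxCommutation st).
- exact: word_cong_refl.
- exact: word_cong_sym.
- exact: word_cong_trans st tr.
Qed.

Lemma cox_length_le (s : seq 'I_n) : cox_length (word_prod s) <= size s.
Proof.
rewrite /cox_length; case: ex_minnP => k _; apply; apply/asboolP.
by exists s.
Qed.

Lemma reduced_expression_exists (w : coxeterA n) :
  exists s, reduced_expression w s.
Proof.
rewrite /reduced_expression /cox_length; case: ex_minnP => k + _.
by move=> /asboolP[s sk sw]; exists s.
Qed.

Definition staircase_elt (l : seq (nat * nat)) : coxeterA n :=
  word_prod (restrict_word (staircase_word l)).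

Lemma staircase_elt_act l s : staircase n n l -> word_prod s = staircase_elt l ->
  word_act (map val s) =1 word_act (staircase_word l).
Proof.
move=> ln /word_prod_eq /word_act_coxeter E x.
by rewrite E restrict_wordK // (staircase_letters ln).
Qed.

Lemma size_staircase_elt l s : staircase n n l -> word_prod s = staircase_elt l ->
  up_displacement n (map val s) = size (staircase_word l).
Proof.
move=> ln sl; rewrite -(staircase_up_displacement ln).
by apply: eq_bigr => x _; rewrite (staircase_elt_act ln sl).
Qed.

(** Every expression s of the element has the displacement of the normal form,
    which is the length of the normal form and at most the length of s. *)
Lemma cox_length_staircase_elt l : staircase n n l ->
  cox_length (staircase_elt l) = size (staircase_word l).
Proof.
move=> ln; apply/eqP; rewrite eqn_leq; apply/andP; split.
  rewrite -(restrict_wordK (staircase_letters ln)) size_map.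
  exact: cox_length_le.
have [s [sl <-]] := reduced_expression_exists (staircase_elt l).
rewrite -(size_staircase_elt ln sl) -(size_map val).
exact: up_displacement_size (map_val_ltn s).
Qed.

(** A reduced expression attains the displacement bound, so commutations bring it
    to some normal form; acting as l does, this normal form is l. *)
Lemma reduced_staircase_elt l s : staircase n n l ->
  reduced_expression (staircase_elt l) s ->
  comm (map val s) (staircase_word l).
Proof.
move=> ln [sl s_size]; have s_n := map_val_ltn s.
have [|k kn sk] := factor_free_staircase s_n.
  apply: tight_factor_free s_n _.
  by rewrite (size_staircase_elt ln sl) size_map s_size cox_length_staircase_elt.
suff <- : k = l by [].
apply: (staircase_act_inj kn ln) => x.
by rewrite -(word_act_comm sk) (staircase_elt_act ln sl).
Qed.

Lemma staircase_elt_fc l : staircase n n l -> fully_commutative (staircase_elt l).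
Proof.
move=> ln s t /(reduced_staircase_elt ln) sl /(reduced_staircase_elt ln) tl.
rewrite -(map_valK s) -(map_valK t); apply: comm_restrict_word.
exact: word_cong_trans sl (word_cong_sym tl).
Qed.

(** A factor ii could be deleted, against minimality of the length; a factor iji
    could be replaced by jij, giving a reduced expression with other letter
    multiplicities, which commutations cannot produce. *)
Lemma fc_factor_free (w : coxeterA n) s : fully_commutative w ->
  reduced_expression w s -> factor_free (map val s).
Proof.
move=> fc [sw s_size] p f r f_red /[dup] sC /comm_perm/perm_all pA.
have := map_val_ltn s; rewrite pA !all_cat => /and3P[p_n f_n r_n].
pose g (x : seq nat) := restrict_word p ++ restrict_word x ++ restrict_word r.
have sg : word_cong (@commutation n) s (g f).
  by have := comm_restrict_word sC; rewrite map_valK /restrict_word !pmap_cat.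
have gw : word_prod (g f) = w.
  by rewrite -sw; apply/word_prod_eq/word_cong_sym/commutation_coxeter.
have g_size : size (g f) = size s.
  rewrite -(size_map val s) (perm_size (comm_perm sC)) !size_cat.
  by rewrite -!(size_map val (restrict_word _)) !restrict_wordK.
case: f_red f_n sC sg gw g_size => [i|i j ij] /=.
  rewrite andbT => /andP[i_n _] sC sg gw g_size.
  have iE : insub i = Some (Ordinal i_n) by rewrite insubT.
  have : word_prod (restrict_word p ++ restrict_word r) = w.
    rewrite -gw; apply/word_prod_eq/word_cong_sym.
    rewrite /g /restrict_word /= iE.
    exact: (word_cong_step (restrict_word p) (restrict_word r) (CoxSquare _)).
  move=> E; have := cox_length_le (restrict_word p ++ restrict_word r).
  rewrite E -s_size -g_size /g /restrict_word /= iE !size_cat /=; lia.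
rewrite andbT => /and3P[i_n j_n _] sC sg gw g_size.
pose i' := Ordinal i_n; pose j' := Ordinal j_n.
have iE : insub i = Some i' by rewrite insubT.
have jE : insub j = Some j' by rewrite insubT.
have braid : word_cong (@coxeter_relation n) (g [:: i; j; i]) (g [:: j; i; j]).
  rewrite /g /restrict_word /= iE jE /=.
  have step a b ab := word_cong_step (restrict_word p) (restrict_word r) (@CoxBraid n a b ab).
  case/orP: ij => /eqP ij; last exact: (step i' j' ij).
  exact: (word_cong_sym (step j' i' ij)).
have red (x : seq 'I_n) : word_cong (@coxeter_relation n) (g [:: i; j; i]) x ->
    size x = size s -> reduced_expression w x.
  move=> gx x_size; split; last by rewrite x_size.
  by rewrite -gw; apply/word_prod_eq/word_cong_sym.
have := fc _ _ (red _ (word_cong_refl _ _) g_size) (red _ braid _).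
have <- : size (g [:: i; j; i]) = size (g [:: j; i; j]).
  by rewrite /g !size_cat /restrict_word /= iE jE.
move=> /(_ g_size) /comm_map_val /comm_perm /permP /(_ (pred1 i)).
rewrite /g /restrict_word /= iE jE !map_cat !count_cat /= eqxx.
by case: eqP; lia.
Qed.

Lemma fc_staircase_elt (w : coxeterA n) : fully_commutative w ->
  exists2 l, staircase n n l & w = staircase_elt l.
Proof.
move=> fc; have [s sw] := reduced_expression_exists w.
have [l ln sl] := factor_free_staircase (map_val_ltn s) (fc_factor_free fc sw).
exists l => //; case: sw => <- _; apply/word_prod_eq/commutation_coxeter.
by rewrite -{1}(map_valK s); exact: comm_restrict_word.
Qed.

Lemma staircase_elt_inj l k : staircase n n l -> staircase n n k ->
  staircase_elt l = staircase_elt k -> l = k.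
Proof.
move=> ln kn lk; apply: (staircase_act_inj ln kn) => x.
rewrite -(staircase_elt_act ln (erefl _)); exact: staircase_elt_act.
Qed.

End FullyCommutative.

Local Open Scope ring_scope.

Lemma fc_poincareE n : fc_poincare n = iter n count_step (fun=> 1) 0%N.
Proof.
rewrite -staircases_weight (fsbig_seq _ _ (staircases_uniq n 0)) /fc_poincare.
have mem l : l \in staircases n 0 -> staircase n n l.
  by rewrite mem_staircases addn0.
rewrite (reindex_fsbig (@staircase_elt n) [set` staircases n 0]).
  by apply: eq_fsbigr => l; rewrite inE /= => /mem/cox_length_staircase_elt ->.
split=> [l /= /mem|l k /[!inE] /= /mem ln /mem kn|w /= /fc_staircase_elt[l ln ->]].
- exact: staircase_elt_fc.
- exact: staircase_elt_inj.
- by exists l => //=; rewrite mem_staircases addn0.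
Qed.

(** * The first column of the inverse *)

Theorem proposition4p3
  (b : nat -> nat -> {poly int}) (hb : b_family b)
  (Pinv : nat -> nat -> {poly int}) (hPinv : imx_inverse (P_matrix b) Pinv)
  (n : nat) (hn : (1 <= n)%N) :
  let a := fc_poincare in
  let u : {poly int} := 'X^(n.+1) * a n.-1 in
  let c := fun i => Pinv i 1%N in
  c n.+2 = - (1 - 'X^2) * u /\
  - (1 - 'X^2) * u = - (1 - 'X^2) * 'X^(n.+1) * a n.-1.
Proof.
case: n hn => // n _ a u c; rewrite /u /a /= mulrA; split=> //.
by rewrite /c (first_column_iter hb n.+2 hPinv) iter_inverse_step_delta fc_poincareE.
Qed.
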